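(* Let $H$ be a finite hypergraph with vertex set $V(H)$ and edge set $E(H)$, having no edges of size $0$ or $1$. Then there are weightings $\omega: E(H)\to\{1,2,3\}$ and $\omega': V(H)\to\{1,2\}$ such that the induced total vertex weights $$w(v):=\omega'(v)+\sum_{e\in E(H),\, e\ni v}\omega(e),\qquad v\in V(H),$$ properly color $V(H)$.
   Context: A hypergraph $H$ consists of a finite vertex set $V(H)$ and a set $E(H)$ of subsets of $V(H)$, called edges; the size of an edge is its number of vertices. A vertex coloring of a hypergraph is proper if there is no monochromatic edge. Thus the total vertex weights $w$ properly color $V(H)$ if every edge $e\in E(H)$ contains two vertices $x,y\in e$ with $w(x)\neq w(y)$. *)

(* Defs.v *)
From mathcomp Require Import all_boot.

Set Implicit Arguments.
Unset Strict Implicit.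
Unset Printing Implicit Defensive.

(* A finite hypergraph is given by a finType V of vertices and a set
   E : {set {set V}} of edges. An edge weighting is a total function on
   {set V}, but only its values on the edges are ever used. *)

Definition total_weight (V : finType) (E : {set {set V}})
    (omega : {set V} -> nat) (omega' : V -> nat) (v : V) : nat :=
  omega' v + \sum_(e in E | v \in e) omega e.

Definition monochromatic (V : finType) (C : eqType) (c : V -> C)
    (e : {set V}) : Prop :=
  forall x y : V, x \in e -> y \in e -> c x = c y.

Definition proper_coloring (V : finType) (C : eqType) (E : {set {set V}})
    (c : V -> C) : Prop :=
  forall e : {set V}, e \in E -> ~ monochromatic c e.

Lemma proper_coloringP (V : finType) (C : eqType) (E : {set {set V}})
    (c : V -> C) :
  proper_coloring E c <->
  forall e : {set V}, e \in E ->
    exists x y : V, [/\ x \in e, y \in e & c x != c y].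
Proof.
split=> [prop_c e eE | sep_c e /sep_c[x [y [xe ye /eqP c_xy]]] /(_ x y xe ye)//].
have [/existsP[x /existsP[y /and3P[xe ye c_xy]]] | no_xy] :=
  boolP [exists x, exists y, [&& x \in e, y \in e & c x != c y]].
  by exists x, y.
case: (prop_c e eE) => x y xe ye; apply/eqP; apply: contraNT no_xy => c_xy.
by apply/existsP; exists x; apply/existsP; exists y; apply/and3P.
Qed.

(* Main.v *)
Require Import Defs.
From mathcomp Require Import all_boot.

Set Implicit Arguments.
Unset Strict Implicit.
Unset Printing Implicit Defensive.

(** The vertices are coloured greedily along a linear order, and every edge
    [e] is made non-monochromatic by its two lowest vertices [x < y], its
    leading pair.

    All edges start with weight 2.  Suppose that the vertices below [y] have
    received their final total weights.  Let [A] be the set of all [x] such that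
    [(x, y)] is the leading pair of some edge, and choose one such edge [f x]
    for each [x] in [A].  The only vertex of [f x] below [y] is [x], so a change
    of the weight of [f x] by one can be hidden from all settled vertices by the
    opposite change of the vertex weight of [x].  Among the weights 1 and 2, each
    [x] allows exactly one such change, up or down; hence the total weight of [y]
    can be moved independently by one for each [x] in [A], and ranges over
    [#|A| + 1] consecutive integers.  One of them avoids the [#|A|] settled total
    weights of the members of [A] ([rebalance]).  Each edge is the chosen edge
    of at most one step, the one of its second lowest vertex, so its weight is
    still 2 at that time and ends in {1, 2, 3}. *)

(** Pigeonhole: one forbidden value cannot block two different shifts. *)
Lemma exists_shift_notin (s : seq nat) (b : nat) :
  exists2 t, t <= size s & b + t \notin s.
Proof.
have [/hasP[t] | /hasPn all_s] :=
  boolP (has (fun t => b + t \notin s) (iota 0 (size s).+1)).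
  by rewrite mem_iota; exists t.
have: size (map (addn b) (iota 0 (size s).+1)) <= size s.
  apply: uniq_leq_size; first by rewrite map_inj_uniq ?iota_uniq //; exact: addnI.
  by move=> _ /mapP[t t_le ->]; have := all_s t t_le; rewrite negbK.
by rewrite size_map size_iota ltnn.
Qed.

Lemma exists_subset_card (T : finType) (A : {set T}) (t : nat) :
  t <= #|A| -> exists2 B : {set T}, B \subset A & #|B| = t.
Proof.
move=> le_tA; exists [set x in take t (enum A)].
  by apply/subsetP=> x; rewrite inE => /mem_take; rewrite mem_enum.
by rewrite cardsE (card_uniqP _) ?take_uniq ?enum_uniq // size_takel -?cardE.
Qed.

(** The step of the greedy colouring, freed from the order: [B] is the set of
    settled vertices, [y] the next vertex, and [f x] an untouched edge through
    [x] and [y] that meets [B] in [x] only. *)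
Lemma rebalance (V : finType) (E : {set {set V}})
    (omega : {set V} -> nat) (omega' : V -> nat)
    (A B : {set V}) (y : V) (f : V -> {set V}) :
    (forall e, omega e \in [:: 1; 2; 3]) ->
    (forall v, omega' v \in [:: 1; 2]) ->
    A \subset B -> y \notin B ->
    (forall x, x \in A -> [/\ f x \in E, x \in f x, y \in f x
                            & omega (f x) = 2]) ->
    (forall x z, x \in A -> z \in B -> z \in f x -> z = x) ->
  exists omega1 omega1',
    [/\ forall e, omega1 e \in [:: 1; 2; 3],
        forall v, omega1' v \in [:: 1; 2],
        forall e, e \notin f @: A -> omega1 e = omega e,
        {in B, total_weight E omega1 omega1' =1 total_weight E omega omega'}
      & forall x, x \in A ->
          total_weight E omega1 omega1' x != total_weight E omega1 omega1' y].
Proof.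
move=> om13 om12 sAB yB fP fB.
have yA : y \notin A by apply: contra yB; exact: (subsetP sAB).
have f_inj : {in A &, injective f}.
  move=> x z xA zA fxz; apply: (fB z) => //; first exact: (subsetP sAB).
  by rewrite -fxz; have [] := fP x xA.
(* For each [x] in [A] the sum of the weights of [x] and [f x] has to stay
   [omega' x + 2].  As the new weight of [x] is 2 or 1, the edge [f x] gets
   [omega' x] or [omega' x + 1]; the set [T] collects the [x] for which it gets
   the larger value. *)
pose om (T : {set V}) (e : {set V}) :=
  if [pick x in A | f x == e] is Some x then omega' x + (x \in T) else omega e.
pose om' (T : {set V}) x := if x \in A then 2 - (x \in T) else omega' x.
have om_f T x : x \in A -> om T (f x) = omega' x + (x \in T).
  move=> xA; rewrite /om; case: pickP => [z /andP[zA /eqP/f_inj->] //|].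
  by move/(_ x); rewrite xA eqxx.
have om_nf T e : e \notin f @: A -> om T e = omega e.
  move=> efA; rewrite /om; case: pickP => // z /andP[zA /eqP fz].
  by case/imsetP: efA; exists z.
have om_B T : {in B, total_weight E (om T) (om' T) =1 total_weight E omega omega'}.
  move=> z zB; rewrite /total_weight /om'.
  have stable (e : {set V}) : z \in e -> ~~ ((z \in A) && (e == f z)) -> om T e = omega e.
    move=> ze nef; apply: om_nf; apply: contra nef => /imsetP[x xA def_e].
    by rewrite (fB x z) -?def_e // xA eqxx.
  case: ifPn => [zA | zA]; last first.
    by congr (_ + _); apply: eq_bigr => e /andP[_ ze]; rewrite stable // (negPf zA).
  have [fzE zfz _ fz2] := fP z zA.
  have balance : 2 - (z \in T) + om T (f z) = omega' z + omega (f z).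
    by rewrite om_f // fz2 addnCA subnK //; case: (z \in T).
  rewrite (bigD1 (f z)) ?fzE //= [in RHS](bigD1 (f z)) ?fzE //= !addnA.
  congr (_ + _); first exact: balance.
  by apply: eq_bigr => e /andP[/andP[_ ze] nef]; rewrite stable // (negPf nef) andbF.
(* Each member of [T] raises the weight of exactly one edge through [y]. *)
have om_y (T : {set V}) : T \subset A ->
    total_weight E (om T) (om' T) y = total_weight E (om set0) (om' set0) y + #|T|.
  move=> sTA; rewrite /total_weight /om' (negPf yA) -addnA; congr (_ + _).
  have -> : #|T| = \sum_(e in E | y \in e) (e \in f @: T).
    rewrite -(card_in_imset (sub_in2 (subsetP sTA) f_inj)) -sum1_card.
    rewrite -big_mkcondr /=; apply: eq_bigl => e.
    apply/idP/idP => [/imsetP[x xT ->] | /andP[] //].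
    by have [-> _ -> _] := fP x (subsetP sTA x xT); rewrite imset_f.
  rewrite -big_split /=; apply: eq_bigr => e _.
  have [/imsetP[x xA ->] | efA] := boolP (e \in f @: A).
    rewrite !om_f // inE addn0; congr (_ + nat_of_bool _).
    apply/idP/imsetP => [xT | [z zT /f_inj ->] //]; first by exists x.
    exact: (subsetP sTA).
  rewrite !om_nf //; case: imsetP => [[x xT def_e] | _]; last by rewrite addn0.
  by case/imsetP: efA; exists x; first exact: (subsetP sTA).
have [t] := exists_shift_notin [seq total_weight E omega omega' x | x <- enum A]
              (total_weight E (om set0) (om' set0) y).
rewrite size_map -cardE => /exists_subset_card[T sTA <-]; rewrite -om_y // => y_new.
exists (om T), (om' T); split=> [e | v | | | x xA].
- rewrite /om; case: pickP => // x _.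
  by have := om12 x; rewrite !inE => /orP[]/eqP->; case: (x \in T).
- by rewrite /om'; case: ifP => // _; case: (v \in T).
- exact: om_nf.
- exact: om_B.
- apply: contra y_new => /eqP<-; rewrite om_B; last exact: (subsetP sAB).
  by apply: map_f; rewrite mem_enum.
Qed.

Definition leading_pair (V : finType) (e : {set V}) (x y : V) : bool :=
  [&& x \in e, y \in e, enum_rank x < enum_rank y
    & [forall z in e, (enum_rank z < enum_rank y) ==> (z == x)]].

Lemma leading_pairP (V : finType) (e : {set V}) (x y : V) :
  reflect [/\ x \in e, y \in e, enum_rank x < enum_rank y
            & forall z, z \in e -> enum_rank z < enum_rank y -> z = x]
          (leading_pair e x y).
Proof.
apply: (iffP and4P) => -[xe ye lt_xy low]; split=> //.
  move=> z ze lt_zy.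
  by apply/eqP; apply: (implyP (forall_inP low z ze)).
by apply/forall_inP=> z ze; apply/implyP=> lt_zy; apply/eqP/low.
Qed.

Lemma exists_leading_pair (V : finType) (e : {set V}) :
  1 < #|e| -> exists x y, leading_pair e x y.
Proof.
have lowest (A : {set V}) : 0 < #|A| ->
    exists2 x, x \in A & forall z, z \in A -> enum_rank x <= enum_rank z.
  case/card_gt0P=> v vA.
  by case: (arg_minnP (fun u : V => enum_rank u : nat) vA) => x; exists x.
move=> e_gt1; have [x xe x_min] := lowest e (ltnW e_gt1).
have [|y /setD1P[yx ye] y_min] := lowest (e :\ x).
  by rewrite (cardsD1 x) xe in e_gt1.
exists x, y; apply/leading_pairP; split=> // [|z ze].
  rewrite ltn_neqAle x_min // andbT.
  by apply: contra yx => /eqP/val_inj/enum_rank_inj->.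
rewrite ltnNge => lt_zy; apply/eqP; apply: contraR lt_zy => zx.
by apply: y_min; rewrite !inE zx.
Qed.

(** The greedy colouring after the first [k] vertices.  The clause on edges of
    weight 2 provides the untouched edges of the next step. *)
Lemma greedy_weighting (V : finType) (E : {set {set V}}) (k : nat) :
  exists (omega : {set V} -> nat) (omega' : V -> nat),
    [/\ forall e, omega e \in [:: 1; 2; 3],
        forall v, omega' v \in [:: 1; 2],
        forall e x y, leading_pair e x y -> k <= enum_rank y -> omega e = 2
      & forall e x y, e \in E -> leading_pair e x y -> enum_rank y < k ->
          total_weight E omega omega' x != total_weight E omega omega' y].
Proof.
elim: k => [|k [om [om' [om13 om12 om2 om_sep]]]].
  by exists (fun=> 2), (fun=> 1).
have [/existsP[y /eqP rk_y] | /existsPn no_y] :=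
    boolP [exists y : V, enum_rank y == k :> nat]; last first.
  exists om, om'; split=> // e x y; first by move=> exy /ltnW; apply: om2 exy.
  by move=> eE exy; rewrite ltnS leq_eqVlt (negPf (no_y y)); apply: om_sep exy.
pose A := [set x | [exists e in E, leading_pair e x y]].
pose B := [set z : V | enum_rank z < k].
pose f x := odflt set0 [pick e in E | leading_pair e x y].
have fP x : x \in A -> f x \in E /\ leading_pair (f x) x y.
  rewrite inE => /exists_inP[e eE exy]; rewrite /f.
  by case: pickP => [e1 /andP[] // | /(_ e)]; rewrite eE exy.
have [||||om1 [om1' [om1_13 om1_12 om1_nf om1_B om1_A]]] :=
    @rebalance V E om om' A B y f om13 om12.
- apply/subsetP=> x /fP[_ /leading_pairP[_ _ lt_xy _]].
  by rewrite inE -rk_y.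
- by rewrite inE rk_y ltnn.
- move=> x /fP[fE fxy]; have /leading_pairP[xf yf _ _] := fxy; split=> //.
  by apply: om2 fxy _; rewrite rk_y.
- move=> x z /fP[_ /leading_pairP[_ _ _ low]].
  by rewrite inE -rk_y => lt_zy ze; apply: low.
exists om1, om1'; split=> // [e x z exz lt_kz | e x z eE exz].
  rewrite om1_nf; first by apply: om2 exz (ltnW lt_kz).
  apply/imsetP=> -[u /fP[_ fuy] def_e].
  (* Otherwise [y] and [u] are two vertices of [e] below [z]. *)
  case/leading_pairP: exz => _ _ _ low; rewrite def_e in low.
  case/leading_pairP: fuy => ue ye lt_uy _.
  have lt_yz : enum_rank y < enum_rank z by rewrite rk_y.
  have uy : u = y by rewrite (low u ue (ltn_trans lt_uy lt_yz)) (low y ye lt_yz).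
  by rewrite uy ltnn in lt_uy.
rewrite ltnS leq_eqVlt => /orP[/eqP rk_z | lt_zk].
  have zy : z = y by apply/enum_rank_inj/val_inj; rewrite /= rk_z rk_y.
  by rewrite zy in exz *; apply: om1_A; rewrite inE; apply/exists_inP; exists e.
have /leading_pairP[_ _ lt_xz _] := exz.
by rewrite !om1_B ?inE ?(ltn_trans lt_xz) //; apply: om_sep exz lt_zk.
Qed.

Theorem theorem10 (V : finType) (E : {set {set V}})
    (hE : forall e : {set V}, e \in E -> 1 < #|e|) :
  exists (omega : {set V} -> nat) (omega' : V -> nat),
    [/\ forall e : {set V}, e \in E -> omega e \in [:: 1; 2; 3],
        forall v : V, omega' v \in [:: 1; 2]
      & proper_coloring E (total_weight E omega omega')].
Proof.
have [om [om' [om13 om12 _ om_sep]]] := @greedy_weighting V E #|V|.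
exists om, om'; split=> // e eE mono.
have [x [y exy]] := exists_leading_pair (hE e eE).
have /leading_pairP[xe ye _ _] := exy.
by have /eqP[] := om_sep e x y eE exy (ltn_ord _); apply: mono.
Qed.
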